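(* For non-negative integers $M_1,M_2$, \[ \sum_{r_1=0}^{M_1}\sum_{r_2=0}^{M_2}\frac{a^{r_1}b^{r_2}q^{r_1^2-r_1r_2+r_2^2}}{(q;q)_{M_1-r_1}(q;q)_{M_2-r_2}}\,\frac{(abq;q)_{r_1+r_2}}{(q,aq,abq;q)_{r_1}(q,bq,abq;q)_{r_2}} =\frac{(abq;q)_{M_1+M_2}}{(q,aq,abq;q)_{M_1}(q,bq,abq;q)_{M_2}}. \]
   Context: $(a;q)_0=1$, $(a;q)_n=\prod_{i=1}^n(1-aq^{i-1})$, and $(a_1,\dots,a_k;q)_n=(a_1;q)_n\cdots(a_k;q)_n$. *)

(* Defs.v *)
From mathcomp Require Import all_boot all_order all_algebra.

Set Implicit Arguments.
Unset Strict Implicit.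
Unset Printing Implicit Defensive.

Import GRing.Theory.

Local Open Scope ring_scope.

(* (a; q)_n; the index i runs from 0, so the factor is 1 - a q^i. *)
Definition qpoch (F : fieldType) (a q : F) (n : nat) : F :=
  \prod_(i < n) (1 - a * q ^+ i).

(* (a_1, ..., a_k; q)_n *)
Definition qpochs (F : fieldType) (s : seq F) (q : F) (n : nat) : F :=
  \prod_(a <- s) qpoch a q n.

(* r1^2 - r1 r2 + r2^2, with the terms reordered because subtraction on nat is
   truncated: r1 * r2 <= r1 ^ 2 + r2 ^ 2 always holds. *)
Definition qform (r1 r2 : nat) : nat := (r1 ^ 2 + r2 ^ 2 - r1 * r2)%N.

(* Main.v *)
Require Import Defs.
From mathcomp Require Import all_boot all_order all_algebra.
From mathcomp Require Import ring zify.

Import GRing.Theory.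
Local Open Scope ring_scope.

(** The two q-Chu-Vandermonde sums evaluate the same quotient
    (cq;q)_(m+n) / ((q,cq;q)_m (q,cq;q)_n): as the sum over k of
    q^((m-k)(n-k)) / ((q)_(m-k) (q)_(n-k) (q,cq)_k), and as the sum over k of
    c^k q^(k^2) / ((q)_(m-k) (q)_(n-k) (q,cq)_k).  Expand the summand by the
    first one with c = ab.  Since
    r1^2 - r1 r2 + r2^2 + (r1-k)(r2-k) = k^2 + r1(r1-k) + r2(r2-k),
    the sums over r1 and r2 separate; each is a q-Vandermonde sum with a closed
    form, and the remaining sum over k is the second expansion. *)

(** * Exponents of q *)

Lemma sqrnS n : (n.+1 ^ 2 = n ^ 2 + n + n.+1)%N.
Proof. lia. Qed.

Lemma qformD r1 r2 k : (k <= r1)%N -> (k <= r2)%N ->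
  (qform r1 r2 + (r1 - k) * (r2 - k)
   = k ^ 2 + r1 * (r1 - k) + r2 * (r2 - k))%N.
Proof.
move=> /subnKC <- /subnKC <-; rewrite /qform !addKn.
move: (r1 - k)%N (r2 - k)%N => x y.
(* This bound makes the truncated subtraction in [qform] exact. *)
have le_prod : ((k + x) * (k + y) <= (k + x) ^ 2 + (k + y) ^ 2)%N by nia.
lia.
Qed.

(** * q-shifted factorials, q-Pascal rules and q-Vandermonde sums *)

Section QSeries.
Set Implicit Arguments.
Unset Strict Implicit.
Context (F : fieldType) (q : F).
Implicit Types (a c : F) (m n k : nat).

(* 1 / (q;q)_(n-k), with the usual convention that it vanishes for k > n. *)
Definition invq n k : F := if (k <= n)%N then (qpoch q q (n - k))^-1 else 0.

Lemma qpoch0 a : qpoch a q 0 = 1.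
Proof. by rewrite /qpoch big_ord0. Qed.

Lemma qpochSr a n : qpoch a q n.+1 = qpoch a q n * (1 - a * q ^+ n).
Proof. by rewrite /qpoch big_ord_recr. Qed.

Lemma qpochSl a n : qpoch a q n.+1 = (1 - a) * qpoch (a * q) q n.
Proof.
rewrite /qpoch big_ord_recl expr0 mulr1; congr (_ * _).
by apply: eq_bigr => i _; rewrite exprS mulrA.
Qed.

Lemma qpochSr_neq0 a n :
  (qpoch a q n.+1 != 0) = (qpoch a q n != 0) && (1 - a * q ^+ n != 0).
Proof. by rewrite qpochSr mulf_eq0 negb_or. Qed.

Lemma qpochSl_neq0 a n :
  (qpoch a q n.+1 != 0) = (1 - a != 0) && (qpoch (a * q) q n != 0).
Proof. by rewrite qpochSl mulf_eq0 negb_or. Qed.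

Lemma qpochD a m n : qpoch a q (m + n) = qpoch a q m * qpoch (a * q ^+ m) q n.
Proof.
rewrite /qpoch big_split_ord; congr (_ * _).
by apply: eq_bigr => i _; rewrite /= exprD mulrA.
Qed.

Lemma qpoch_neq0W a m n :
  (m <= n)%N -> qpoch a q n != 0 -> qpoch a q m != 0.
Proof. by move=> /subnKC <-; rewrite qpochD mulf_eq0 negb_or => /andP[]. Qed.

Lemma invq0r n : invq n 0 = (qpoch q q n)^-1.
Proof. by rewrite /invq subn0. Qed.

Lemma invqSS n k : invq n.+1 k.+1 = invq n k.
Proof. by rewrite /invq ltnS subSS. Qed.

Lemma invq_gt n k : (n < k)%N -> invq n k = 0.
Proof. by rewrite /invq ltnNge => /negbTE->. Qed.

Lemma invqD n k s : invq (n + k) (s + k) = invq n s.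
Proof. by rewrite /invq leq_add2r subnDr. Qed.

(** The left factor cancels the last factor of (q;q)_(n+1-k). At k = n+1 it is 1 - q^0 = 0, in
    agreement with the zero convention of [invq]. *)
Lemma invqS n k : qpoch q q n.+1 != 0 -> (k <= n.+1)%N ->
  (1 - q ^+ (n.+1 - k)) * invq n.+1 k = invq n k.
Proof.
move=> qn0; rewrite leq_eqVlt => /predU1P[->|].
  by rewrite subnn subrr mul0r invq_gt.
rewrite ltnS => kn; rewrite /invq kn leqW // subSn // qpochSr -exprS.
have := qpoch_neq0W (leq_subr k n.+1) qn0.
rewrite subSn // qpochSr_neq0 -exprS => /andP[h1 h2].
by field; rewrite h1 h2.
Qed.

(* The two q-Pascal rules for 1 / ((q)_(m-k) (q)_k), in summed form. *)
Lemma sum_pascal1 m (f : nat -> F) : qpoch q q m.+1 != 0 ->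
  (1 - q ^+ m.+1) * \sum_(0 <= k < m.+2) invq m.+1 k / qpoch q q k * f k
  = \sum_(0 <= k < m.+1) invq m k / qpoch q q k * (f k.+1 + q ^+ k * f k).
Proof.
move=> qm0; rewrite mulr_sumr.
(* Split 1 - q^(m+1) = (1 - q^k) + q^k (1 - q^(m+1-k)). *)
rewrite (eq_big_nat _ _ (F2 := fun k =>
  (1 - q ^+ k) * invq m.+1 k / qpoch q q k * f k
  + invq m k / qpoch q q k * (q ^+ k * f k))); last first.
  move=> k /andP[_]; rewrite ltnS => km.
  rewrite -(invqS qm0 km) -{1}(subnKC km) exprD; ring.
(* The first sum loses its term k = 0 and is shifted by one; the second loses its term k = m+1. *)
rewrite big_split /= big_nat_recl // expr0 subrr !mul0r add0r.
rewrite [X in _ + X]big_nat_recr //= invq_gt // !mul0r addr0 -big_split /=.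
apply: eq_big_nat => k /andP[_ km]; rewrite mulrDr; congr (_ + _).
rewrite invqSS qpochSr -exprS.
have := qpoch_neq0W km qm0.
rewrite qpochSr_neq0 -exprS => /andP[h1 h2].
by field; rewrite h1 h2.
Qed.

Lemma sum_pascal2 m (f : nat -> F) : qpoch q q m.+1 != 0 ->
  (1 - q ^+ m.+1) * \sum_(0 <= k < m.+2) invq m.+1 k / qpoch q q k * f k
  = \sum_(0 <= k < m.+1)
      invq m k / qpoch q q k * (q ^+ (m - k) * f k.+1 + f k).
Proof.
move=> qm0; rewrite mulr_sumr.
(* The other split: 1 - q^(m+1) = q^(m+1-k) (1 - q^k) + (1 - q^(m+1-k)). *)
rewrite (eq_big_nat _ _ (F2 := fun k =>
  (1 - q ^+ k) * invq m.+1 k / qpoch q q k * (q ^+ (m.+1 - k) * f k)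
  + invq m k / qpoch q q k * f k)); last first.
  move=> k /andP[_]; rewrite ltnS => km.
  rewrite -(invqS qm0 km) -{1}(subnKC km) exprD; ring.
rewrite big_split /= big_nat_recl // expr0 subrr !mul0r add0r.
rewrite [X in _ + X]big_nat_recr //= invq_gt // !mul0r addr0 -big_split /=.
apply: eq_big_nat => k /andP[_ km]; rewrite mulrDr; congr (_ + _).
rewrite invqSS subSS qpochSr -exprS.
have := qpoch_neq0W km qm0.
rewrite qpochSr_neq0 -exprS => /andP[h1 h2].
by field; rewrite h1 h2.
Qed.

(** Formally the limit of [q_vandermonde2] as n tends to infinity. After the first Pascal rule, the
    two terms at s combine through a q^(s+1) + (1 - a q^(s+1)) = 1 into the summand for m with a
    replaced by aq, so induction on m applies. *)
Lemma q_vandermonde_lim m a :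
  qpoch q q m != 0 -> qpoch (a * q) q m != 0 ->
  \sum_(0 <= s < m.+1)
    invq m s / qpoch q q s * (a ^+ s * q ^+ (s ^ 2) / qpoch (a * q) q s)
  = (qpoch q q m * qpoch (a * q) q m)^-1.
Proof.
elim: m a => [|m IH] a qm0 am0.
  by rewrite big_nat1 invq0r !qpoch0 /= !expr0 !(invr1, mulr1).
have := qm0; rewrite qpochSr_neq0 -exprS => /andP[q0 qS0].
have := am0; rewrite qpochSl_neq0 => /andP[aq0 a0].
apply: (mulfI qS0); rewrite sum_pascal1 //.
transitivity ((1 - a * q)^-1 * \sum_(0 <= s < m.+1)
  invq m s / qpoch q q s
    * ((a * q) ^+ s * q ^+ (s ^ 2) / qpoch (a * q * q) q s)).
  rewrite mulr_sumr; apply: eq_big_nat => s /andP[_ sm].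
  rewrite /=; have e := qpochSl (a * q) s.
  have e' := e; rewrite qpochSr in e'.
  have := qpoch_neq0W sm am0; rewrite qpochSr_neq0 => /andP[h1 h2].
  have h3 : qpoch (a * q * q) q s != 0.
    by apply: contraTneq (qpoch_neq0W sm am0) => h; rewrite e h mulr0 eqxx.
  rewrite sqrnS.
  rewrite e !exprD !exprMn !exprS.
  set x := q ^+ s in e' h2 *; set y := q ^+ (s ^ 2); set z := a ^+ s.
  have -> : qpoch (a * q) q s
            = (1 - a * q) * qpoch (a * q * q) q s / (1 - a * q * x).
    by rewrite -e' mulfK.
  by field; rewrite aq0 h3 h2 (qpoch_neq0W (ltnW sm) qm0).
rewrite IH // [qpoch q q m.+1]qpochSr -exprS qpochSl; field.
by rewrite aq0 a0 q0 qS0.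
Qed.

(** Induction on m: the first Pascal rule turns the sum for (m+1, n+1, c) into a combination of
    those for (m, n, cq) and (m, n+1, c). *)
Lemma q_vandermonde1 m n c :
  qpoch q q m != 0 -> qpoch (c * q) q m != 0 ->
  qpoch q q n != 0 -> qpoch (c * q) q n != 0 ->
  \sum_(0 <= k < m.+1) invq m k / qpoch q q k *
    (q ^+ ((m - k) * (n - k)) * invq n k / qpoch (c * q) q k)
  = qpoch (c * q) q (m + n)
    / (qpoch q q m * qpoch (c * q) q m * (qpoch q q n * qpoch (c * q) q n)).
Proof.
elim: m n c => [|m IH] n c qm0 cm0 qn0 cn0.
  rewrite big_nat1 !invq0r !qpoch0 mul0n expr0 add0n.
  by field; rewrite qn0 cn0 oner_eq0.
case: n qn0 cn0 => [|n] qn0 cn0.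
  rewrite big_nat_recl // big1_seq => [|k _]; last first.
    by rewrite [invq 0 _]invq_gt // mulr0 mul0r mulr0.
  rewrite !invq0r !qpoch0 muln0 expr0 addn0.
  by field; rewrite qm0 cm0 oner_eq0.
have := qm0; rewrite qpochSr_neq0 -exprS => /andP[q0 qS0].
have := cm0; rewrite qpochSl_neq0 => /andP[cq0 c0].
have := cm0; rewrite qpochSr_neq0 => /andP[c0' cS0].
have := cn0; rewrite qpochSl_neq0 => /andP[_ d0].
have := qn0; rewrite qpochSr_neq0 -exprS => /andP[r0 rS0].
apply: (mulfI qS0).
rewrite (@sum_pascal1 _ (fun k => q ^+ ((m.+1 - k) * (n.+1 - k))
                                 * invq n.+1 k / qpoch (c * q) q k)) //.
transitivity ((1 - c * q)^-1 * (\sum_(0 <= k < m.+1) invq m k / qpoch q q k *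
    (q ^+ ((m - k) * (n - k)) * invq n k / qpoch (c * q * q) q k))
  + q ^+ n.+1 * (\sum_(0 <= k < m.+1) invq m k / qpoch q q k *
    (q ^+ ((m - k) * (n.+1 - k)) * invq n.+1 k / qpoch (c * q) q k))).
  rewrite !mulr_sumr -big_split /=; apply: eq_big_nat => k /andP[_ km].
  rewrite /= invqSS !subSS qpochSl invfM mulrDr; congr (_ + _); first by ring.
  (* For k > n+1 the exponents are truncated, but [invq] makes both sides zero. *)
  case: (leqP k n.+1) => kn; last by rewrite [invq n.+1 k]invq_gt //; ring.
  have -> : ((m.+1 - k) * (n.+1 - k) = (m - k) * (n.+1 - k) + (n.+1 - k))%N.
    by rewrite subSn // mulSn addnC.
  rewrite -{4}(subnKC kn) !exprD; ring.
rewrite (IH n (c * q)) // (IH n.+1 c) //.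
have e1 := qpochSl (c * q) (m + n); have e2 := qpochSl (c * q) m.
have e3 := qpochSl (c * q) n; have e4 := qpochSr (c * q) m.
rewrite !addSn !addnS [qpoch (c * q) q (m + n).+2]qpochSr e1 e3.
rewrite [qpoch q q n.+1]qpochSr [qpoch q q m.+1]qpochSr.
rewrite e4.
(* All factorials are now expressed through common ones, so a rational identity remains. *)
have -> : qpoch (c * q * q) q m
          = qpoch (c * q) q m * (1 - c * q * q ^+ m) / (1 - c * q).
  by rewrite -e4 e2 [RHS]mulrC mulKf.
rewrite !exprS exprD; rewrite !exprS in qS0 rS0.
by field; rewrite cq0 c0' cS0 d0 r0 rS0 q0 qS0.
Qed.

(** Same induction, with the second Pascal rule: its factor q^(m-k) turns the q^(2k+1) coming from
    (k+1)^2 into q^(m+1) q^k, and the q^k changes c^k into (cq)^k. *)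
Lemma q_vandermonde2 m n c :
  qpoch q q m != 0 -> qpoch (c * q) q m != 0 ->
  qpoch q q n != 0 -> qpoch (c * q) q n != 0 ->
  \sum_(0 <= k < m.+1) invq m k / qpoch q q k *
    (c ^+ k * q ^+ (k ^ 2) * invq n k / qpoch (c * q) q k)
  = qpoch (c * q) q (m + n)
    / (qpoch q q m * qpoch (c * q) q m * (qpoch q q n * qpoch (c * q) q n)).
Proof.
elim: m n c => [|m IH] n c qm0 cm0 qn0 cn0.
  rewrite big_nat1 !invq0r !qpoch0 !expr0 add0n.
  by field; rewrite qn0 cn0 oner_eq0.
case: n qn0 cn0 => [|n] qn0 cn0.
  rewrite big_nat_recl // big1_seq => [|k _]; last first.
    by rewrite [invq 0 _]invq_gt // mulr0 mul0r mulr0.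
  rewrite !invq0r !qpoch0 !expr0 addn0.
  by field; rewrite qm0 cm0 oner_eq0.
have := qm0; rewrite qpochSr_neq0 -exprS => /andP[q0 qS0].
have := cm0; rewrite qpochSl_neq0 => /andP[cq0 c0].
have := cm0; rewrite qpochSr_neq0 => /andP[c0' cS0].
have := cn0; rewrite qpochSl_neq0 => /andP[_ d0].
have := qn0; rewrite qpochSr_neq0 -exprS => /andP[r0 rS0].
apply: (mulfI qS0).
rewrite (@sum_pascal2 _ (fun k => c ^+ k * q ^+ (k ^ 2)
                                 * invq n.+1 k / qpoch (c * q) q k)) //.
transitivity (c * q ^+ m.+1 / (1 - c * q)
  * (\sum_(0 <= k < m.+1) invq m k / qpoch q q k *
    ((c * q) ^+ k * q ^+ (k ^ 2) * invq n k / qpoch (c * q * q) q k))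
  + (\sum_(0 <= k < m.+1) invq m k / qpoch q q k *
    (c ^+ k * q ^+ (k ^ 2) * invq n.+1 k / qpoch (c * q) q k))).
  rewrite !mulr_sumr -big_split /=; apply: eq_big_nat => k /andP[_ km].
  rewrite /= invqSS qpochSl invfM mulrDr; congr (_ + _).
  rewrite sqrnS.
  rewrite -{3}(subnKC (km : (k <= m)%N)) !(exprS, exprD) exprMn; ring.
rewrite (IH n (c * q)) // (IH n.+1 c) //.
have e1 := qpochSl (c * q) (m + n); have e2 := qpochSl (c * q) m.
have e3 := qpochSl (c * q) n; have e4 := qpochSr (c * q) m.
rewrite !addSn !addnS [qpoch (c * q) q (m + n).+2]qpochSr e1 e3.
rewrite [qpoch q q n.+1]qpochSr [qpoch q q m.+1]qpochSr.
rewrite e4.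
have -> : qpoch (c * q * q) q m
          = qpoch (c * q) q m * (1 - c * q * q ^+ m) / (1 - c * q).
  by rewrite -e4 e2 [RHS]mulrC mulKf.
rewrite !exprS exprD; rewrite !exprS in qS0 rS0.
by field; rewrite cq0 c0' cS0 d0 r0 rS0 q0 qS0.
Qed.

(** Terms with r < k vanish; putting r = s + k gives [q_vandermonde_lim] for M - k and a q^k. *)
Lemma sum_invq_invq M k a :
  qpoch q q M != 0 -> qpoch (a * q) q M != 0 ->
  \sum_(0 <= r < M.+1)
    a ^+ r * q ^+ (r * (r - k)) * invq M r * invq r k / qpoch (a * q) q r
  = a ^+ k * invq M k / qpoch (a * q) q M.
Proof.
move=> qM0 aM0; case: (leqP k M) => [kM|Mk]; last first.
  rewrite (invq_gt Mk) mulr0 mul0r big1_seq // => r.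
  rewrite mem_index_iota => /andP[_ /= rM].
  by rewrite (invq_gt (leq_trans rM Mk)) mulr0 mul0r.
have := aM0; rewrite -{1}(subnKC kM) qpochD mulf_eq0 negb_or => /andP[ak0 aMk0].
rewrite (@big_cat_nat _ _ _ k) //=; last exact: leqW.
rewrite big1_seq ?add0r => [|r]; last first.
  rewrite mem_index_iota => /andP[_ /= rk].
  by rewrite (invq_gt rk) mulr0 mul0r.
rewrite -{1}(add0n k) big_addn subSn //.
have qMk := qpoch_neq0W (leq_subr k M) qM0.
have aqk : a * q * q ^+ k = a * q ^+ k * q by ring.
rewrite aqk in aMk0.
transitivity (a ^+ k / qpoch (a * q) q k * \sum_(0 <= s < (M - k).+1)
    invq (M - k) s / qpoch q q s
      * ((a * q ^+ k) ^+ s * q ^+ (s ^ 2) / qpoch (a * q ^+ k * q) q s)).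
  rewrite mulr_sumr; apply: eq_big_nat => s /andP[_ sm].
  rewrite -{1}(subnK kM) invqD addnK [invq (s + k) k]/invq leq_addl addnK.
  rewrite [(s + k)%N]addnC qpochD aqk invfM.
  rewrite mulnDl mulnn.
  rewrite !exprD exprMn exprM; ring.
have -> : qpoch (a * q) q M
          = qpoch (a * q) q k * qpoch (a * q ^+ k * q) q (M - k).
  by rewrite -{1}(subnKC kM) qpochD aqk.
rewrite q_vandermonde_lim // /invq kM.
by field; rewrite ak0 aMk0 qMk.
Qed.

End QSeries.

(** * Separation and evaluation of the double sum *)

Theorem theorem5p2 (F : fieldType) (a b q : F) (M1 M2 : nat)
    (hden1 : qpochs [:: q; a * q; a * b * q] q M1 != 0)
    (hden2 : qpochs [:: q; b * q; a * b * q] q M2 != 0) :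
  \sum_(0 <= r1 < M1.+1) \sum_(0 <= r2 < M2.+1)
     (a ^+ r1 * b ^+ r2 * q ^+ qform r1 r2
        / (qpoch q q (M1 - r1) * qpoch q q (M2 - r2)))
     * (qpoch (a * b * q) q (r1 + r2)
        / (qpochs [:: q; a * q; a * b * q] q r1
           * qpochs [:: q; b * q; a * b * q] q r2))
  = qpoch (a * b * q) q (M1 + M2)
    / (qpochs [:: q; a * q; a * b * q] q M1
       * qpochs [:: q; b * q; a * b * q] q M2).
Proof.
have qpochs3 x y z n : qpochs [:: x; y; z] q n
    = qpoch x q n * (qpoch y q n * qpoch z q n).
  by rewrite /qpochs !big_cons big_nil mulr1.
move: hden1 hden2; rewrite !qpochs3 !mulf_eq0 !negb_or.
move=> /and3P[q1 a1 c1] /and3P[q2 b2 c2].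
pose w k : F := q ^+ (k ^ 2) / (qpoch q q k * qpoch (a * b * q) q k).
pose S (x : F) M k r : F := x ^+ r * q ^+ (r * (r - k)) * invq q M r
                              * invq q r k / qpoch (x * q) q r.
transitivity (\sum_(0 <= r1 < M1.+1) \sum_(0 <= r2 < M2.+1)
    \sum_(0 <= k < M1.+1) w k * (S a M1 k r1 * S b M2 k r2)).
  apply: eq_big_nat => r1 /andP[_ r1M]; apply: eq_big_nat => r2 /andP[_ r2M].
  rewrite !ltnS in r1M r2M.
  (* The terms with r1 < k are zero: they only make the range of k independent of r1, so that the
     sums can be exchanged. *)
  rewrite (@big_cat_nat _ _ _ r1.+1) //= [X in _ = _ + X]big1_seq ?addr0; last first.
    move=> k; rewrite mem_index_iota => /andP[_ /andP[r1k _]].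
    by rewrite /S (@invq_gt _ _ r1 k) // mulr0 !mul0r mulr0.
  have qr1 := qpoch_neq0W r1M q1.
  have cr1 := qpoch_neq0W r1M c1.
  have qr2 := qpoch_neq0W r2M q2.
  have cr2 := qpoch_neq0W r2M c2.
  have ar1 := qpoch_neq0W r1M a1.
  have br2 := qpoch_neq0W r2M b2.
  transitivity (a ^+ r1 * b ^+ r2 * q ^+ qform r1 r2
      * invq q M1 r1 * invq q M2 r2
      / (qpoch (a * q) q r1 * qpoch (b * q) q r2)
      * (qpoch (a * b * q) q (r1 + r2)
         / (qpoch q q r1 * qpoch (a * b * q) q r1
            * (qpoch q q r2 * qpoch (a * b * q) q r2)))).
    by rewrite !qpochs3 /invq r1M r2M !invfM; ring.
  rewrite -q_vandermonde1 // mulr_sumr.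
  apply: eq_big_nat => k /andP[_]; rewrite ltnS => kr1; rewrite /w /S.
  case: (leqP k r2) => kr2; last by rewrite [invq _ r2 k]invq_gt //; ring.
  have e : q ^+ qform r1 r2 * q ^+ ((r1 - k) * (r2 - k))
      = q ^+ (k ^ 2) * q ^+ (r1 * (r1 - k)) * q ^+ (r2 * (r2 - k)).
    by rewrite -!exprD qformD.
  rewrite !invfM; ring: e.
transitivity (\sum_(0 <= k < M1.+1) w k
  * ((\sum_(0 <= r1 < M1.+1) S a M1 k r1)
     * (\sum_(0 <= r2 < M2.+1) S b M2 k r2))).
  under eq_bigr do rewrite exchange_big /=.
  rewrite exchange_big /=; apply: eq_bigr => k _.
  rewrite mulr_suml mulr_sumr; apply: eq_bigr => r1 _.
  by rewrite !mulr_sumr.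
(* The two inner sums contribute a^k and b^k, hence the power (ab)^k of the second expansion. *)
under eq_bigr do rewrite /S !sum_invq_invq //.
transitivity ((qpoch (a * q) q M1 * qpoch (b * q) q M2)^-1
  * (qpoch (a * b * q) q (M1 + M2)
     / (qpoch q q M1 * qpoch (a * b * q) q M1
        * (qpoch q q M2 * qpoch (a * b * q) q M2)))); last first.
  by rewrite !invfM; ring.
rewrite -q_vandermonde2 // mulr_sumr; apply: eq_bigr => k _.
rewrite /w exprMn !invfM; ring.
Qed.
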